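(* For every closed expression $e$ of the core language and every type $\tau$ (generated by $\tau ::= \mathtt{int} \mid \mathtt{bool} \mid \tau\to\tau$), $\mathrm{TC}(e,\tau)$ holds if and only if $\models e:\tau$.
   Context: **Core language.** Values: $v ::= n\ (n\in\mathbb Z) \mid b\ (b\in\mathbb B=\{\mathtt{true},\mathtt{false}\}) \mid \mathtt{fun}\ x \to e$. Expressions: $e ::= v \mid x \mid e\ e \mid e\odot e \mid \mathtt{if}\ e\ \mathtt{then}\ e\ \mathtt{else}\ e \mid e\sim p \mid \mathtt{pick\_i} \mid \mathtt{pick\_b} \mid \mathtt{ERROR}$, with $x$ a variable, $\odot\in\{+,-,<,=,\mathtt{and},\mathtt{or},\mathtt{xor}\}$ and patterns $p ::= \mathtt{int}\mid\mathtt{bool}\mid\mathtt{fun}$. $\mathtt{ERROR}$ is not a value. $\mathtt{let}\ x = e_1\ \mathtt{in}\ e_2$ abbreviates $(\mathtt{fun}\ x\to e_2)\ e_1$. Types: $\tau ::= \mathtt{int}\mid\mathtt{bool}\mid\tau\to\tau$. The language is untyped; bound, free and closed are standard. **Operational semantics.** Reduction contexts: $R ::= \bullet \mid R\ e \mid e\ R \mid R\odot e \mid v\odot R \mid \mathtt{if}\ R\ \mathtt{then}\ e\ \mathtt{else}\ e \mid R\sim p$; $R[[e]]$ is $R$ with $\bullet$ replaced by $e$. The single-step relation $\rightarrow^1$ on closed expressions is the least relation such that: (Red) if a redex $r\rightarrow^1 e$ by one of the basic rules below, then $R[[r]]\rightarrow^1 R[[e]]$; (Err) if $e\rightarrow^1\mathtt{ERROR}$,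 then $R[[e]]\rightarrow^1\mathtt{ERROR}$; also $R[[\mathtt{ERROR}]]\rightarrow^1\mathtt{ERROR}$ for $R\neq\bullet$. Basic rules: $n_1+n_2\rightarrow^1$ their integer sum if $n_1,n_2\in\mathbb Z$; $v_1+v_2\rightarrow^1\mathtt{ERROR}$ if $v_1$ or $v_2$ is not an integer; the other operators $\odot$ behave analogously (integer operands for $-,<,=$; boolean operands for $\mathtt{and},\mathtt{or},\mathtt{xor}$; otherwise $\mathtt{ERROR}$). $(\mathtt{fun}\ x\to e)\ v\rightarrow^1 e[v/x]$; $v\ v'\rightarrow^1\mathtt{ERROR}$ if $v$ is not a function value. $\mathtt{if}\ \mathtt{true}\ \mathtt{then}\ e\ \mathtt{else}\ e'\rightarrow^1 e$; $\mathtt{if}\ \mathtt{false}\ \mathtt{then}\ e\ \mathtt{else}\ e'\rightarrow^1 e'$; $\mathtt{if}\ v\ \mathtt{then}\ e\ \mathtt{else}\ e'\rightarrow^1\mathtt{ERROR}$ if $v$ is not boolean. $\mathtt{pick\_i}\rightarrow^1 n$ for every $n\in\mathbb Z$; $\mathtt{pick\_b}\rightarrow^1 b$ for every $b\in\mathbb B$. $v\sim p\rightarrow^1\mathtt{true}$ if $v$ is respectively an integer ($p=\mathtt{int}$), a boolean ($p=\mathtt{bool}$), a function value ($p=\mathtt{fun}$), and $v\sim p\rightarrow^1\mathtt{false}$ otherwise. $\rightarrow^*$ is the reflexive transitive closure of $\rightarrow^1$; $e\not\rightarrow^* e'$ is its negation. **Semantic typing** ($e$ closed, values closed), by induction on $\tau$: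 - $\models e:\mathtt{int}$ iff $e\not\rightarrow^*\mathtt{ERROR}$ and for all $v$, if $e\rightarrow^* v$ then $v\in\mathbb Z$. - $\models e:\mathtt{bool}$ iff $e\not\rightarrow^*\mathtt{ERROR}$ and for all $v$, if $e\rightarrow^* v$ then $v\in\mathbb B$. - $\models e:\tau_1\to\tau_2$ iff $e\not\rightarrow^*\mathtt{ERROR}$ and for all $v_f$, if $e\rightarrow^* v_f$, then for all $v$, if $\models v:\tau_1$ then $\models v_f\ v:\tau_2$. **Checkers and generators** (core-language expressions, defined by mutual recursion on $\tau$): - $\mathrm{Checker}(\mathtt{int},e)= e\sim\mathtt{int}$; $\mathrm{Checker}(\mathtt{bool},e)= e\sim\mathtt{bool}$. - $\mathrm{Checker}(\tau_1\to\tau_2,e)=\mathtt{if}\ e\sim\mathtt{fun}\ \mathtt{then}\ (\mathtt{let}\ arg=\mathrm{Generator}(\tau_1)\ \mathtt{in}\ \mathrm{Checker}(\tau_2,\,e\ arg))\ \mathtt{else}\ \mathtt{false}$. - $\mathrm{Generator}(\mathtt{int})=\mathtt{pick\_i}$; $\mathrm{Generator}(\mathtt{bool})=\mathtt{pick\_b}$. - $\mathrm{Generator}(\tau_1\to\tau_2)=\mathtt{fun}\ x\to \mathtt{if}\ \mathtt{pick\_b}\ \mathtt{then}\ (\mathtt{if}\ \mathrm{Checker}(\tau_1,x)\ \mathtt{then}\ \mathrm{Generator}(\tau_2)\ \mathtt{else}\ \mathtt{ERROR})\ \mathtt{else}\ \mathrm{Generator}(\tau_2)$. **Type checking relation.**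 $\mathrm{TC}(e,\tau)$ holds iff $\mathrm{Checker}(\tau,e)\not\rightarrow^*\mathtt{ERROR}$ and for all $v$, if $\mathrm{Checker}(\tau,e)\rightarrow^* v$ then $v=\mathtt{true}$. *)

(* Defs.v *)
From Stdlib Require Import Relation_Operators.
From mathcomp Require Import all_boot all_order all_algebra.

Set Implicit Arguments.
Unset Strict Implicit.
Unset Printing Implicit Defensive.

Definition var := nat.

Inductive binop := Plus | Minus | Less | Equal | And | Or | Xor.

Inductive pat := PInt | PBool | PFun.

Inductive value :=
  | VInt of int
  | VBool of bool
  | VFun of var & expr
with expr :=
  | Val of value
  | Var of var
  | App of expr & expr
  | Op of binop & expr & expr
  | If of expr & expr & expr
  | Match of expr & pat
  | PickI
  | PickB
  | Error.

Coercion Val : value >-> expr.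

Definition LetIn (x : var) (e1 e2 : expr) : expr := App (VFun x e2) e1.

Inductive ty := TInt | TBool | TArrow of ty & ty.

Fixpoint fv (e : expr) : seq var :=
  match e with
  | Val v => fv_value v
  | Var x => [:: x]
  | App e1 e2 | Op _ e1 e2 => fv e1 ++ fv e2
  | If e1 e2 e3 => fv e1 ++ fv e2 ++ fv e3
  | Match e1 _ => fv e1
  | PickI | PickB | Error => [::]
  end
with fv_value (v : value) : seq var :=
  match v with
  | VInt _ | VBool _ => [::]
  | VFun x e => [seq y <- fv e | y != x]
  end.

Definition closed (e : expr) : Prop := fv e = [::].

(* [subst x v e] is e[v/x]. No renaming of binders is performed, which is
   correct because [v] is always closed when reducing a closed expression. *)
Fixpoint subst (x : var) (v : value) (e : expr) : expr :=
  match e with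
  | Val w => subst_value x v w
  | Var y => if y == x then Val v else Var y
  | App e1 e2 => App (subst x v e1) (subst x v e2)
  | Op o e1 e2 => Op o (subst x v e1) (subst x v e2)
  | If e1 e2 e3 => If (subst x v e1) (subst x v e2) (subst x v e3)
  | Match e1 p => Match (subst x v e1) p
  | PickI => PickI
  | PickB => PickB
  | Error => Error
  end
with subst_value (x : var) (v w : value) : value :=
  match w with
  | VInt n => VInt n
  | VBool b => VBool b
  | VFun y e => VFun y (if y == x then e else subst x v e)
  end.

Inductive ctx :=
  | CHole
  | CAppL of ctx & expr
  | CAppR of expr & ctx
  | COpL of binop & ctx & expr
  | COpR of binop & value & ctx
  | CIf of ctx & expr & expr
  | CMatch of ctx & pat.

Fixpoint fill (R : ctx) (e : expr) : expr :=
  match R with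
  | CHole => e
  | CAppL R1 e2 => App (fill R1 e) e2
  | CAppR e1 R2 => App e1 (fill R2 e)
  | COpL o R1 e2 => Op o (fill R1 e) e2
  | COpR o v R2 => Op o v (fill R2 e)
  | CIf R1 e2 e3 => If (fill R1 e) e2 e3
  | CMatch R1 p => Match (fill R1 e) p
  end.

Definition is_int (v : value) : bool := if v is VInt _ then true else false.
Definition is_bool (v : value) : bool := if v is VBool _ then true else false.
Definition is_fun (v : value) : bool := if v is VFun _ _ then true else false.

Definition matches (v : value) (p : pat) : bool :=
  match p with
  | PInt => is_int v
  | PBool => is_bool v
  | PFun => is_fun v
  end.

Definition op_eval (o : binop) (v1 v2 : value) : expr :=
  match o, v1, v2 with
  | Plus, VInt m, VInt n => VInt (m + n)%R
  | Minus, VInt m, VInt n => VInt (m - n)%R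
  | Less, VInt m, VInt n => VBool (m < n)%R
  | Equal, VInt m, VInt n => VBool (m == n)
  | And, VBool a, VBool b => VBool (a && b)
  | Or, VBool a, VBool b => VBool (a || b)
  | Xor, VBool a, VBool b => VBool (a (+) b)
  | _, _, _ => Error
  end.

Inductive basic_step : expr -> expr -> Prop :=
  | BOp o (v1 v2 : value) : basic_step (Op o v1 v2) (op_eval o v1 v2)
  | BApp x e (v : value) : basic_step (App (VFun x e) v) (subst x v e)
  | BAppErr (v v' : value) : ~~ is_fun v -> basic_step (App v v') Error
  | BIfTrue e e' : basic_step (If (VBool true) e e') e
  | BIfFalse e e' : basic_step (If (VBool false) e e') e'
  | BIfErr (v : value) e e' : ~~ is_bool v -> basic_step (If v e e') Error
  | BPickI n : basic_step PickI (VInt n)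
  | BPickB b : basic_step PickB (VBool b)
  | BMatch (v : value) p : basic_step (Match v p) (VBool (matches v p)).

(* The relation is meant on closed expressions. Contexts do not cross binders,
   so only closed expressions are reachable from a closed one and no closedness
   side condition is needed. *)
Inductive step : expr -> expr -> Prop :=
  | SRed R r e : basic_step r e -> step (fill R r) (fill R e)
  | SErr R e : step e Error -> step (fill R e) Error
  | SError R : R <> CHole -> step (fill R Error) Error.

Definition steps : expr -> expr -> Prop := clos_refl_trans expr step.

Fixpoint sem_typed (e : expr) (t : ty) : Prop :=
  match t with
  | TInt => ~ steps e Error /\ (forall v : value, steps e v -> is_int v)
  | TBool => ~ steps e Error /\ (forall v : value, steps e v -> is_bool v)
  | TArrow t1 t2 =>
      ~ steps e Error /\
      (forall vf : value, steps e vf ->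
       forall v : value, closed v -> sem_typed v t1 -> sem_typed (App vf v) t2)
  end.

Definition fresh (e : expr) : var := (\max_(x <- fv e) x).+1.

(* The bound variable [arg] must not capture the free variables of [e], which
   is open when a checker occurs under the binder of a generator or of an outer
   checker. Generators are closed, so their bound variable can be fixed. *)
Fixpoint checker (t : ty) (e : expr) : expr :=
  match t with
  | TInt => Match e PInt
  | TBool => Match e PBool
  | TArrow t1 t2 =>
      let arg := fresh e in
      If (Match e PFun)
         (LetIn arg (generator t1) (checker t2 (App e (Var arg))))
         (VBool false)
  end
with generator (t : ty) : expr :=
  match t with
  | TInt => PickI
  | TBool => PickB
  | TArrow t1 t2 =>
      let x : var := 0 in
      VFun x (If PickB
                 (If (checker t1 (Var x)) (generator t2) Error)
                 (generator t2))
  end.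

Definition TC (e : expr) (t : ty) : Prop :=
  ~ steps (checker t e) Error /\
  (forall v : value, steps (checker t e) v -> v = VBool true).

(* Main.v *)
(* Both sides are compared with a step-indexed logical relation.  [good t k v]
   says that [v] cannot be told apart from an element of [t] by evaluations with
   at most [k] beta-reductions.  Indices are needed because the language has
   general recursion: an argument passed to a function under test may contain
   that same function, so an induction on types alone is circular.

   That [good] at all indices makes the checker succeed is an induction on
   types, the generators being good themselves.  Conversely a generator is the
   worst inhabitant of its type: if [e'] arises from [e] by replacing closed
   subterms that are good up to [k] by generators, then [e] is good up to [k]
   unless the checker refutes [e'].  In the crucial step a good function [f] is
   applied to [w], and a generator to the image [w'] of [w].  Either [w] is good
   at a smaller index, so that [f w] is good and is matched by the generator of
   the result type; or, inductively, the checker refutes [w'], and the generator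
   raises [ERROR].  Only the evaluation of [e] is counted, not that of [e']. *)

From Stdlib Require Import Relation_Operators Operators_Properties.
From mathcomp Require Import all_boot zify.
Require Import Defs.

Set Implicit Arguments.
Unset Strict Implicit.
Unset Printing Implicit Defensive.

(* Closed expressions and substitution *)
Scheme expr_value_ind := Induction for expr Sort Prop
  with value_expr_ind := Induction for value Sort Prop.
Combined Scheme expr_value_mutind from expr_value_ind, value_expr_ind.

Lemma cat_eq_nil (T : Type) (s1 s2 : seq T) :
  s1 ++ s2 = [::] <-> s1 = [::] /\ s2 = [::].
Proof. by case: s1 => [|x s1]; split=> // -[]. Qed.

Lemma closed_app e1 e2 : closed (App e1 e2) <-> closed e1 /\ closed e2.
Proof. exact: cat_eq_nil. Qed.

Lemma closed_op o e1 e2 : closed (Op o e1 e2) <-> closed e1 /\ closed e2.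
Proof. exact: cat_eq_nil. Qed.

Lemma closed_if e1 e2 e3 :
  closed (If e1 e2 e3) <-> [/\ closed e1, closed e2 & closed e3].
Proof.
rewrite /closed /=; split=> [|[-> -> ->] //].
by move=> /cat_eq_nil [-> /cat_eq_nil [-> ->]].
Qed.

Lemma subst_id x v e : x \notin fv e -> subst x v e = e.
Proof.
move: e x v; pose P e := forall x v, x \notin fv e -> subst x v e = e.
pose Q w := forall x v, x \notin fv_value w -> subst_value x v w = w.
have [//] : (forall e, P e) /\ (forall w, Q w).
apply: expr_value_mutind; rewrite /P /Q //=.
- by move=> w IHw x v xw; rewrite IHw.
- by move=> y x v; rewrite inE eq_sym => /negbTE ->.
- by move=> e1 IH1 e2 IH2 x v; rewrite mem_cat => /norP [/IH1 -> /IH2 ->].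
- by move=> o e1 IH1 e2 IH2 x v; rewrite mem_cat => /norP [/IH1 -> /IH2 ->].
- move=> e1 IH1 e2 IH2 e3 IH3 x v.
  by rewrite !mem_cat => /norP [/IH1 -> /norP [/IH2 -> /IH3 ->]].
- by move=> e IH p x v /IH ->.
- move=> y e IH x v; rewrite mem_filter negb_and negbK eq_sym.
  by case: eqP => //= _ /IH ->.
Qed.

Lemma subst_closed x v e : closed e -> subst x v e = e.
Proof. by move=> ce; apply: subst_id; rewrite ce. Qed.

Lemma fv_subst x (v : value) e : closed v ->
  fv (subst x v e) = [seq y <- fv e | y != x].
Proof.
move=> cv; move: e.
pose P e := fv (subst x v e) = [seq y <- fv e | y != x].
pose Q w := fv_value (subst_value x v w) = [seq y <- fv_value w | y != x].
have [//] : (forall e, P e) /\ (forall w, Q w).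
apply: expr_value_mutind; rewrite /P /Q //=.
- by move=> y; case: eqP => //= _; exact: cv.
- by move=> e1 -> e2 ->; rewrite filter_cat.
- by move=> o e1 -> e2 ->; rewrite filter_cat.
- by move=> e1 -> e2 -> e3 ->; rewrite !filter_cat.
- move=> y e IH; case: eqP => [->|_]; first by rewrite filter_id.
  by rewrite IH -!filter_predI; apply: eq_filter => z; rewrite /= andbC.
Qed.

Lemma closed_subst x (v : value) b :
  closed (VFun x b) -> closed v -> closed (subst x v b).
Proof. by move=> cb cv; rewrite /closed fv_subst. Qed.

(** * Bound variables of checkers and generators *)

(* The checker with the bound variable given explicitly.  After a [let] of the
   checker is reduced, the inner binders are not the ones [checker] would
   choose, but they are still of this form. *)
Fixpoint checker_from (n : var) (t : ty) (e : expr) : expr :=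
  match t with
  | TInt => Match e PInt
  | TBool => Match e PBool
  | TArrow t1 t2 =>
      If (Match e PFun)
         (LetIn n (generator t1) (checker_from n.+1 t2 (App e (Var n))))
         (VBool false)
  end.

(** The largest free variable of [App e (Var (fresh e))] is [fresh e], so nested checkers choose
    consecutive numbers as binders. *)
Lemma checkerE t e : checker t e = checker_from (fresh e) t e.
Proof.
elim: t e => //= t1 _ t2 IH e; rewrite IH.
suff -> : fresh (App e (Var (fresh e))) = (fresh e).+1 by [].
by rewrite {1}/fresh /= big_cat big_seq1 /= (maxn_idPr (leqnSn _)).
Qed.

Lemma fresh_closed e : closed e -> fresh e = 1.
Proof. by rewrite /fresh => ->; rewrite big_nil. Qed.

Lemma generator_arrow t1 t2 :
  generator (TArrow t1 t2) =
  VFun 0 (If PickB (If (checker_from 1 t1 (Var 0)) (generator t2) Error)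
             (generator t2)).
Proof. by rewrite /= checkerE /fresh /= big_seq1. Qed.

(** Joint induction: the generator at an arrow type contains the checker of the domain, and the
    checker contains the generator of the domain. *)
Lemma fv_generator_checker t :
  closed (generator t) /\ forall n e, {subset fv (checker_from n t e) <= fv e}.
Proof.
elim: t => [||t1 [cg1 cc1] t2 [cg2 cc2]]; try by split=> // n e x.
split.
  rewrite generator_arrow /closed /= cg2 !cats0.
  apply/eqP; rewrite -[_ == _]negbK -has_filter; apply/hasPn => x /cc1.
  by rewrite inE negbK.
move=> n e x /=; rewrite !cg1 !cats0 mem_cat => /orP [//|].
rewrite mem_filter => /andP [xn /cc2] /=.
by rewrite mem_cat inE (negbTE xn) orbF.
Qed.

Lemma closed_generator t : closed (generator t).
Proof. by have [] := fv_generator_checker t. Qed.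

(** All binders introduced are at least [n], hence different from [x], and the generators inside are
    closed. *)
Lemma subst_checker_from x v n t e : x < n ->
  subst x v (checker_from n t e) = checker_from n t (subst x v e).
Proof.
elim: t n e => //= t1 _ t2 IH n e xn.
rewrite gtn_eqF // IH ?ltnS ?(ltnW xn) //= gtn_eqF //.
by rewrite (subst_closed _ _ (closed_generator t1)).
Qed.

(** * Counted big-step evaluation and its agreement with reduction *)

(* [eval k e r]: [e] evaluates to [r], a value or [Error], using exactly [k]
   beta-reductions. *)
Inductive eval : nat -> expr -> expr -> Prop :=
  | EVal (v : value) : eval 0 v v
  | EError : eval 0 Error Error
  | EPickI n : eval 0 PickI (VInt n)
  | EPickB b : eval 0 PickB (VBool b)
  | EMatch k e p (v : value) :
      eval k e v -> eval k (Match e p) (VBool (matches v p))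
  | EMatchErr k e p : eval k e Error -> eval k (Match e p) Error
  | EOp k1 k2 o e1 e2 (v1 v2 : value) :
      eval k1 e1 v1 -> eval k2 e2 v2 ->
      eval (k1 + k2) (Op o e1 e2) (op_eval o v1 v2)
  | EOpErrL k o e1 e2 : eval k e1 Error -> eval k (Op o e1 e2) Error
  | EOpErrR k1 k2 o e1 e2 (v1 : value) :
      eval k1 e1 v1 -> eval k2 e2 Error -> eval (k1 + k2) (Op o e1 e2) Error
  | EIf k1 k2 e e1 e2 b r :
      eval k1 e (VBool b) -> eval k2 (if b then e1 else e2) r ->
      eval (k1 + k2) (If e e1 e2) r
  | EIfBad k e e1 e2 (v : value) :
      eval k e v -> ~~ is_bool v -> eval k (If e e1 e2) Error
  | EIfErr k e e1 e2 : eval k e Error -> eval k (If e e1 e2) Error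
  | EApp k1 k2 k3 e1 e2 x b (v : value) r :
      eval k1 e1 (VFun x b) -> eval k2 e2 v -> eval k3 (subst x v b) r ->
      eval (k1 + k2 + k3).+1 (App e1 e2) r
  | EAppBad k1 k2 e1 e2 (v1 v2 : value) :
      eval k1 e1 v1 -> eval k2 e2 v2 -> ~~ is_fun v1 ->
      eval (k1 + k2) (App e1 e2) Error
  | EAppErrL k e1 e2 : eval k e1 Error -> eval k (App e1 e2) Error
  | EAppErrR k e1 e2 : eval k e2 Error -> eval k (App e1 e2) Error.

Definition evals (e r : expr) : Prop := exists k, eval k e r.

Lemma eval_closed k e r : eval k e r -> closed e -> closed r.
Proof.
elim=> {k e r} //=.
- by move=> k1 k2 [] e1 e2 [?|?|? ?] [?|?|? ?].
- move=> k1 k2 e e1 e2 b r _ _ _ IH /closed_if [_ c1 c2].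
  by apply: IH; case: b.
- move=> k1 k2 k3 e1 e2 x b v r _ IH1 _ IH2 _ IH3 /closed_app [/IH1 c1 /IH2 c2].
  exact/IH3/closed_subst.
Qed.

Lemma evals_closed e r : evals e r -> closed e -> closed r.
Proof. by case=> k; exact: eval_closed. Qed.

Lemma evals_app e1 e2 x b (v : value) r :
  evals e1 (VFun x b) -> evals e2 v -> evals (subst x v b) r ->
  evals (App e1 e2) r.
Proof. by move=> [k1 h1] [k2 h2] [k3 h3]; eexists; apply: EApp h1 h2 h3. Qed.

Lemma evals_if e e1 e2 b r :
  evals e (VBool b) -> evals (if b then e1 else e2) r -> evals (If e e1 e2) r.
Proof. by move=> [k1 h1] [k2 h2]; eexists; apply: EIf h1 h2. Qed.

Lemma evals_val (v : value) : evals v v.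
Proof. by exists 0; constructor. Qed.

Lemma evals_match e p (v : value) :
  evals e v -> evals (Match e p) (VBool (matches v p)).
Proof. by move=> [k h]; exists k; constructor. Qed.

(** The hole is never under a binder, so [fill R e] depends on [e] only through its outcomes. The
    number of beta-reductions may change, which is why the count is hidden. *)
Lemma evals_fill R e e' : (forall r, evals e r -> evals e' r) ->
  forall r, evals (fill R e) r -> evals (fill R e') r.
Proof.
move=> ee'; elim: R => [|R IH e2|e1 R IH|o R IH e2|o v R IH|R IH e1 e2|R IH p] r;
  first exact: ee';
  move=> /=; case=> k h; inversion h; subst;
  repeat match goal with
  | H : eval ?k (fill R e) ?r |- _ =>
      have {H} [? ?] := IH r (ex_intro _ k H)
  end; by eexists; econstructor; eauto.
Qed.

Lemma evals_fill_error R e : evals e Error -> evals (fill R e) Error.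
Proof.
move=> ee; elim: R => [|R [k IH] e2|e1 R [k IH]|o R [k IH] e2|o v R [k IH]|
  R [k IH] e1 e2|R [k IH] p] //=; try by exists k; constructor.
by eexists; apply: EOpErrR IH; constructor.
Qed.

Lemma basic_step_evals r e s : basic_step r e -> evals e s -> evals r s.
Proof.
case=> {r e}.
- move=> o v1 v2 es; suff <- : op_eval o v1 v2 = s.
    by exists (0 + 0); apply: EOp; constructor.
  by case: o v1 v2 es => [] [?|?|? ?] [?|?|? ?] [k h]; inversion h.
- by move=> x e v; apply: evals_app; exact: evals_val.
- move=> v v' nf [k h]; inversion h; subst.
  by exists (0 + 0); apply: EAppBad nf; constructor.
- by move=> e e'; apply: (@evals_if _ _ _ true); exact: evals_val.
- by move=> e e'; apply: (@evals_if _ _ _ false); exact: evals_val.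
- move=> v e e' nb [k h]; inversion h; subst.
  by exists 0; apply: EIfBad nb; constructor.
- by move=> n [k h]; inversion h; exists 0; constructor.
- by move=> b [k h]; inversion h; exists 0; constructor.
- by move=> v p [k h]; inversion h; apply: evals_match; exact: evals_val.
Qed.

Lemma evals_Error : evals Error Error.
Proof. by exists 0; constructor. Qed.

(** This backward form composes along a reduction sequence. The rules that discard a context are
    covered because [Error] has itself as only outcome. *)
Lemma step_evals e e' r : step e e' -> evals e' r -> evals e r.
Proof.
move=> st; elim: st r => {e e'}.
- by move=> R r e rs s; apply: evals_fill => s'; exact: basic_step_evals.
- move=> R e _ IH r [k h]; inversion h; subst.
  exact/evals_fill_error/IH/evals_Error.
- move=> R _ r [k h]; inversion h; subst.
  exact/evals_fill_error/evals_Error.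
Qed.

Lemma steps_evals e e' r : steps e e' -> evals e' r -> evals e r.
Proof.
move=> /(clos_rt_rt1n _ _ _ _) h; elim: h => // x y z xy _ IH /IH.
exact: step_evals.
Qed.

Fixpoint ctx_comp (R1 R2 : ctx) : ctx :=
  match R1 with
  | CHole => R2
  | CAppL R e => CAppL (ctx_comp R R2) e
  | CAppR e R => CAppR e (ctx_comp R R2)
  | COpL o R e => COpL o (ctx_comp R R2) e
  | COpR o v R => COpR o v (ctx_comp R R2)
  | CIf R e1 e2 => CIf (ctx_comp R R2) e1 e2
  | CMatch R p => CMatch (ctx_comp R R2) p
  end.

Lemma fill_comp R1 R2 e : fill (ctx_comp R1 R2) e = fill R1 (fill R2 e).
Proof. by elim: R1 => //= [R ->|? R ->|? R ->|? ? R ->|R ->|R ->]. Qed.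

Lemma step_Error e : ~ step Error e.
Proof.
move eqE: Error => e0 h; elim: h eqE => {e0 e}.
- by case=> // r e rs /= h; rewrite -h in rs; inversion rs.
- by case=> //= e _ IH.
- by case.
Qed.

(** A step to [ERROR] discards its context, so reductions do not lift to contexts in general. A
    sequence ending in a value avoids such steps, because [Error] is stuck. *)
Lemma steps_fill R e (v : value) : steps e v -> steps (fill R e) (fill R v).
Proof.
move=> /(clos_rt_rt1n _ _ _ _); move eqv: (Val v) => e' h.
elim: h eqv => {e e'} [e _|e1 e2 e3 h12 h23 IH eqv]; first exact: rt_refl.
apply: rt_trans (IH eqv); apply: rt_step; subst e3.
case: h12 h23 {IH} => {e1 e2} [R' r e rs _|R' e _ h|R' _ h].
- by rewrite -!fill_comp; constructor.
- by inversion h as [|y z hy]; subst; case: (step_Error hy).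
- by inversion h as [|y z hy]; subst; case: (step_Error hy).
Qed.

Lemma steps_fill_Error R e : steps e Error -> steps (fill R e) Error.
Proof.
have fE : steps (fill R Error) Error.
  by case: R => [|R e2|e1 R|o R e2|o v R|R e1 e2|R p];
    [exact: rt_refl | apply/rt_step/SError..].
move=> /(clos_rt_rt1n _ _ _ _); move eqE: {1}Error => e' h.
elim: h eqE => {e e'} [e <- //|e1 e2 e3 h12 _ IH /IH {}IH].
case: h12 IH => {e1 e2} [R' r e rs|R' e st _|R' _ _].
- by rewrite -!fill_comp; apply/rt_trans/rt_step/SRed.
- by rewrite -fill_comp; apply: rt_step; exact: SErr.
- case: R' => [|R' e2|e1 R'|o R' e2|o v R'|R' e1 e2|R' p]; first by [];
  by rewrite -fill_comp; case: R {fE} => *; apply: rt_step; exact: SError.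
Qed.

Lemma steps_app_r e1 e2 (v2 : value) r :
  steps e2 v2 -> steps (App e1 v2) r -> steps (App e1 e2) r.
Proof. by move=> /(steps_fill (CAppR e1 CHole)); exact: rt_trans. Qed.

Lemma steps_basic e e' r : basic_step e e' -> steps e' r -> steps e r.
Proof. by move=> /(SRed CHole) h; apply/rt_trans/rt_step. Qed.

Lemma eval_steps k e r : eval k e r -> steps e r.
Proof.
elim=> {k e r}.
- by move=> v; exact: rt_refl.
- exact: rt_refl.
- by move=> n; apply/steps_basic/rt_refl; constructor.
- by move=> b; apply/steps_basic/rt_refl; constructor.
- move=> k e p v _ /(steps_fill (CMatch CHole p)) h.
  by apply: rt_trans h _; apply/steps_basic/rt_refl; constructor.
- by move=> k e p _; exact: (steps_fill_Error (CMatch CHole p)).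
- move=> k1 k2 o e1 e2 v1 v2 _ /(steps_fill (COpL o CHole e2)) h1.
  move=> _ /(steps_fill (COpR o v1 CHole)) h2.
  apply: rt_trans h1 _; apply: rt_trans h2 _.
  by apply/steps_basic/rt_refl; constructor.
- by move=> k o e1 e2 _; exact: (steps_fill_Error (COpL o CHole e2)).
- move=> k1 k2 o e1 e2 v1 _ /(steps_fill (COpL o CHole e2)) h1.
  move=> _ /(steps_fill_Error (COpR o v1 CHole)).
  exact: rt_trans h1.
- move=> k1 k2 e e1 e2 b r _ /(steps_fill (CIf CHole e1 e2)) h1 _ h2.
  apply: rt_trans h1 _; apply: steps_basic h2.
  by case: b; constructor.
- move=> k e e1 e2 v _ /(steps_fill (CIf CHole e1 e2)) h1 nb.
  by apply: rt_trans h1 _; apply/steps_basic/rt_refl; constructor.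
- by move=> k e e1 e2 _; exact: (steps_fill_Error (CIf CHole e1 e2)).
- move=> k1 k2 k3 e1 e2 x b v r _ /(steps_fill (CAppL CHole e2)) h1.
  move=> _ h2 _ h3; apply: rt_trans h1 _; apply: steps_app_r h2 _.
  by apply: steps_basic h3; constructor.
- move=> k1 k2 e1 e2 v1 v2 _ /(steps_fill (CAppL CHole e2)) h1 _ h2 nf.
  apply: rt_trans h1 _; apply: steps_app_r h2 _.
  by apply/steps_basic/rt_refl; constructor.
- by move=> k e1 e2 _; exact: (steps_fill_Error (CAppL CHole e2)).
(* The context [CAppR] leaves the function part arbitrary: an error in the argument propagates even
   if [e1] diverges. *)
- by move=> k e1 e2 _; exact: (steps_fill_Error (CAppR e1 CHole)).
Qed.

Lemma steps_valP e (v : value) : steps e v <-> evals e v.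
Proof.
split=> [h|[k h]]; first exact: steps_evals h (evals_val v).
exact: eval_steps h.
Qed.

Lemma steps_ErrorP e : steps e Error <-> evals e Error.
Proof.
split=> [h|[k h]]; first exact: steps_evals h evals_Error.
exact: eval_steps h.
Qed.

(** * The step-indexed logical relation *)

(** Evaluations that exceed the budget are not observed, and divergence is always allowed. An
    outcome keeps the budget that is left over. *)
Definition safe (P : nat -> value -> Prop) (k : nat) (e : expr) : Prop :=
  forall j r, j <= k -> eval j e r -> exists2 v, r = Val v & P (k - j) v.

(** The strict bound [i < k] pays for the beta-reduction that performs the application; it is what
    lets later inductions descend on the index. *)
Fixpoint good (t : ty) (k : nat) (v : value) : Prop :=
  match t with
  | TInt => is_int v
  | TBool => is_bool v
  | TArrow t1 t2 =>
      if v is VFun x b then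
        forall i (w : value), i < k -> closed w -> good t1 i w ->
        safe (good t2) i (subst x w b)
      else False
  end.

Lemma good_mono t i k v : i <= k -> good t k v -> good t i v.
Proof.
case: t => //= t1 t2 ik; case: v => // x b h j w ji; apply: h.
exact: leq_trans ik.
Qed.

Lemma safe_mono t i k e : i <= k -> safe (good t) k e -> safe (good t) i e.
Proof.
move=> ik h j r ji /h [|v -> gv]; first exact: leq_trans ik.
by exists v => //; apply: good_mono gv; exact: leq_sub2r.
Qed.

Lemma safe_val t k (v : value) : safe (good t) k v <-> good t k v.
Proof.
split=> [h|gv j r jk h].
  by have [w [->]] := h 0 v (leq0n k) (EVal v); rewrite subn0.
by inversion h; subst; exists v => //; rewrite subn0.
Qed.

Lemma safe_app t1 t2 k e (w : value) :
  closed w -> safe (good (TArrow t1 t2)) k e -> good t1 k w ->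
  safe (good t2) k (App e w).
Proof.
move=> cw he gw j r jk h; inversion h as [| | | | | | | | | | | |
  k1 k2 k3 e1 e2 x b v s h1 h2 h3|k1 k2 e1 e2 v1 v2 h1 h2 nf|k1 e1 e2 h1|
  k1 e1 e2 h1]; subst.
- inversion h2; subst.
  have [|vf [<-] gf] := he _ _ _ h1; first lia.
  (* After [k1] reductions for the function and one for the call itself, [k - k1 - 1] remain for the
     body. *)
  have [||||v' -> gv'] := gf (k - k1 - 1) _ _ _ _ k3 r _ h3 => //; try lia.
    by apply: good_mono gw; lia.
  by exists v' => //; apply: good_mono gv'; lia.
- have [|v [eqv] gv] := he _ _ _ h1; first lia.
  by subst; case: v gv nf {h h1}.
- by have [|v] := he _ _ _ h1.
- by inversion h1.
Qed.

Definition valid (t : ty) (e : expr) : Prop := forall k, safe (good t) k e.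

Lemma safe_eval_val P k e j (v : value) :
  safe P k e -> j <= k -> eval j e v -> P (k - j) v.
Proof. by move=> he jk /(he _ _ jk) [v' [->]]. Qed.

Lemma safe_match P k e j p r : safe P k e -> j <= k -> eval j (Match e p) r ->
  exists2 v, P (k - j) v & r = VBool (matches v p).
Proof.
move=> he jk h; inversion h as [| | | |? ? ? v h1|? ? ? h1| | | | | | | | | |].
  by exists v => //; exact: safe_eval_val h1.
by have [] := he _ _ jk h1.
Qed.

(** * Generators are good, and checkers accept good expressions *)

(** The two claims need each other at smaller types. A generated function tests its good argument,
    and the test can only yield [true]; a checker applies a good function to a generated, hence
    good, argument. *)
Lemma generator_valid_checker_true t :
  valid t (generator t) /\
  forall k n e j r, 0 < n -> closed e -> safe (good t) k e -> j <= k ->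
    eval j (checker_from n t e) r -> r = VBool true.
Proof.
elim: t => [||t1 [vg1 ck1] t2 [vg2 ck2]].
- split=> [k j r _ h|k n e j r _ _ he jk h].
    by inversion h; subst; eexists.
  by have [v /= -> ->] := safe_match he jk h.
- split=> [k j r _ h|k n e j r _ _ he jk h].
    by inversion h; subst; eexists.
  by have [v /= -> ->] := safe_match he jk h.
split=> [k|k n e j r n0 ce he jk h].
  rewrite generator_arrow; apply/safe_val => i w ik cw gw j r ji.
  rewrite /= subst_checker_from //= (subst_closed _ _ (closed_generator t2)).
  have G2 j1 j2 s : j1 + j2 <= i -> eval j2 (generator t2) s ->
      exists2 v, s = Val v & good t2 (i - (j1 + j2)) v.
    move=> ij /(vg2 i) [|v -> gv]; first lia.
    by exists v => //; apply: good_mono gv; lia.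
  have C j1 s : eval j1 (checker_from 1 t1 w) s -> j1 <= i -> s = VBool true.
    by move=> h ji'; apply: ck1 ji' h => //; apply/safe_val.
  move=> h; inversion h as [| | | | | | | | |k1 k2 e0 e1 e2 b s h1 h2|
    ? ? ? ? v h1 nb|? ? ? ? h1| | | |]; subst; last by inversion h1.
    inversion h1; subst; case: b h1 h2 => h1 h2; last exact: G2 h2.
    inversion h2 as [| | | | | | | | |k3 k4 e3 e4 e5 b s h3 h4|
      ? ? ? ? v h3 nb|? ? ? ? h3| | | |]; subst.
    + case: (C _ _ h3 ltac:(lia)) => eqb; subst b.
      by rewrite addnA add0n; apply: G2 h4; lia.
    + by case: (C _ _ h3 ltac:(lia)) => eqv; subst v.
    + by have := C _ _ h3 ltac:(lia).
  by inversion h1; subst.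
have M j1 s : eval j1 (Match e PFun) s -> j1 <= k -> s = VBool true.
  by move=> hm j1k; move: hm => /(safe_match he j1k) [[]] // x b _ ->.
inversion h as [| | | | | | | | |k1 k2 e0 e1 e2 b s h1 h2|
  ? ? ? ? v h1 nb|? ? ? ? h1| | | |]; subst.
- case: (M _ _ h1 ltac:(lia)) => eqb; subst b.
  inversion h2 as [| | | | | | | | | | | |
    k3 k4 k5 e3 e4 x b v s h3 h4 h5|k3 k4 e3 e4 v1 v2 h3 h4 nf|k3 e3 e4 h3|
    k3 e3 e4 h3]; subst.
  + inversion h3; subst; move: h5; rewrite subst_checker_from //= eqxx.
    rewrite (subst_closed _ _ ce).
    (* The generator is good at every index, so starting from [k + k4] leaves index [k] for the
       generated value. *)
    have gv := safe_eval_val (vg1 (k + k4)) (leq_addl k k4) h4.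
    have cv : closed v := eval_closed h4 (closed_generator t1).
    have ha : safe (good t2) k (App e v).
      by apply: (safe_app cv he); apply: good_mono gv; lia.
    by apply: (ck2 k _ (App e v)) => //; [exact/closed_app | lia].
  + by inversion h3; subst.
  + by inversion h3.
  + by have [] := vg1 _ _ _ (leqnn _) h3.
- by case: (M _ _ h1 jk) => eqv; subst v.
- by have := M _ _ h1 jk.
Qed.

Lemma generator_valid t : valid t (generator t).
Proof. by have [] := generator_valid_checker_true t. Qed.

(** * Counterexamples found by checkers *)

Definition rejects (c : expr) : Prop :=
  evals c Error \/ evals c (VBool false).

(* A counterexample found by the checker, with the [let]s of the checker
   resolved and the function evaluated before it is applied. *)
Fixpoint fails (t : ty) (e : expr) : Prop :=
  match t with
  | TInt => rejects (Match e PInt)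
  | TBool => rejects (Match e PBool)
  | TArrow t1 t2 =>
      rejects (Match e PFun) \/
      exists vf g : value,
        [/\ evals e vf, evals (generator t1) g & fails t2 (App vf g)]
  end.

Lemma fails_mono t e e' :
  (forall r, evals e r -> evals e' r) -> fails t e -> fails t e'.
Proof.
move=> ee'; have M p r := @evals_fill (CMatch CHole p) _ _ ee' r.
case: t => [||t1 t2] /=; try by case=> /M; [left | right].
case=> [[] /M h|[vf [g [h1 h2 h3]]]]; [by left; left | by left; right|].
by right; exists vf, g; split=> //; exact: ee'.
Qed.

Lemma fails_error t e : evals e Error -> fails t e.
Proof.
move=> he; have M p := @evals_fill_error (CMatch CHole p) _ he.
by case: t => [||t1 t2] /=; do ?left; exact: M.
Qed.

(** The checker evaluates [e] anew at each occurrence. By nondeterminism some run gets the same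
    function [vf] each time, so a failure of [App vf g] is also one of [App e g]. *)
Lemma fails_rejects t n e :
  0 < n -> closed e -> fails t e -> rejects (checker_from n t e).
Proof.
elim: t n e => //= t1 _ t2 IH n e n0 ce.
have Mf : rejects (Match e PFun) ->
    rejects (checker_from n (TArrow t1 t2) e).
  case=> hm; first by left; exact: (evals_fill_error (CIf CHole _ _) hm).
  by right; apply: (evals_if hm); exact: evals_val.
case=> [/Mf //|[vf [g [h1 h2 h3]]]].
(* If [vf] is no function, the test [e ~ fun] already yields [false]. *)
case nf : (is_fun vf); last first.
  by apply: Mf; right; have := evals_match PFun h1; rewrite /= nf.
have cg : closed g := evals_closed h2 (closed_generator t1).
have {h3} h3 : fails t2 (App e g).
  apply: fails_mono h3 => r; apply: (@evals_fill (CAppL CHole g)) => s [k h].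
  by inversion h; subst.
have L r : evals (checker_from n.+1 t2 (App e g)) r ->
    evals (checker_from n (TArrow t1 t2) e) r.
  move=> h; apply: (@evals_if _ _ _ true).
    by have := evals_match PFun h1; rewrite /= nf.
  apply: (evals_app (evals_val _) h2).
  by rewrite subst_checker_from //= eqxx (subst_closed _ _ ce).
have [] := IH n.+1 _ isT _ h3; first exact/closed_app.
  by move/L; left.
by move/L; right.
Qed.

(** The two directions that need no simulation. That the absence of a counterexample implies [valid]
    is the remaining, hard link. *)
Lemma TC_valid_fails t e : closed e ->
  (TC e t -> ~ fails t e) /\ (valid t e -> TC e t).
Proof.
move=> ce; rewrite /TC checkerE fresh_closed //; split.
  move=> [nE T] /(fails_rejects (isT : 0 < 1) ce) [/steps_ErrorP // |].
  by move/steps_valP/T.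
have [_ C] := generator_valid_checker_true t.
move=> ve; split=> [/steps_ErrorP [k h]|v /steps_valP [k h]].
  by have := C k 1 e k _ isT ce (ve k) (leqnn k) h.
by case: (C k 1 e k _ isT ce (ve k) (leqnn k) h).
Qed.

(** * Replacing good subterms by generators *)

(* [rel k e e']: [e'] is obtained from [e] by replacing some closed subterms
   that behave as elements of [t] up to index [k] by [generator t]. *)
Inductive rel (k : nat) : expr -> expr -> Prop :=
  | RGen t e : closed e -> safe (good t) k e -> rel k e (generator t)
  | RInt n : rel k (VInt n) (VInt n)
  | RBool b : rel k (VBool b) (VBool b)
  | RFun x b b' : rel k b b' -> rel k (VFun x b) (VFun x b')
  | RVar x : rel k (Var x) (Var x)
  | RApp e1 e1' e2 e2' :
      rel k e1 e1' -> rel k e2 e2' -> rel k (App e1 e2) (App e1' e2')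
  | ROp o e1 e1' e2 e2' :
      rel k e1 e1' -> rel k e2 e2' -> rel k (Op o e1 e2) (Op o e1' e2')
  | RIf e1 e1' e2 e2' e3 e3' :
      rel k e1 e1' -> rel k e2 e2' -> rel k e3 e3' ->
      rel k (If e1 e2 e3) (If e1' e2' e3')
  | RMatch e e' p : rel k e e' -> rel k (Match e p) (Match e' p)
  | RPickI : rel k PickI PickI
  | RPickB : rel k PickB PickB
  | RError : rel k Error Error.

Lemma rel_refl k e : rel k e e.
Proof.
move: e; pose P e := rel k e e; pose Q (w : value) := rel k w w.
have [//] : (forall e, P e) /\ (forall w, Q w).
by apply: expr_value_mutind; rewrite /P /Q //=; constructor.
Qed.

Lemma rel_mono i k e e' : i <= k -> rel k e e' -> rel i e e'.
Proof.
move=> ik; elim=> {e e'}; try by constructor.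
by move=> t e ce /(safe_mono ik); constructor.
Qed.

(** The replaced subterms and the generators put in their place are closed, so substitution leaves
    both unchanged. *)
Lemma rel_subst k x b b' (w w' : value) :
  rel k w w' -> rel k b b' -> rel k (subst x w b) (subst x w' b').
Proof.
move=> ww'; elim=> {b b'} /=; try by constructor.
- move=> t e ce he; rewrite !subst_closed //; last exact: closed_generator.
  exact: RGen.
- by move=> y b b' h IH; apply: RFun; case: eqP.
- by move=> y; case: eqP => _ //; exact: RVar.
Qed.

(** Inversion of [rel] on values. Generators of base type are not values, so a generator can occur
    here only at an arrow type, opposite a function. *)
Variant rel_val (k : nat) : value -> value -> Prop :=
  | RVInt n : rel_val k (VInt n) (VInt n)
  | RVBool b : rel_val k (VBool b) (VBool b)
  | RVFun x b b' : rel k b b' -> rel_val k (VFun x b) (VFun x b')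
  | RVGen t1 t2 x b g :
      closed (VFun x b) -> good (TArrow t1 t2) k (VFun x b) ->
      generator (TArrow t1 t2) = Val g -> is_fun g ->
      rel_val k (VFun x b) g.

Lemma rel_valP k (v v' : value) : rel k v v' -> rel_val k v v'.
Proof.
move eqe: (Val v) => e; move eqe': (Val v') => e' h.
case: h eqe eqe' => {e e'} //.
- move=> t e + + eqe; subst e => cv + eqg.
  case: t eqg => // t1 t2 eqg /safe_val.
  by case: v cv => // x b cv gv; apply: RVGen cv gv (esym eqg) _; case: eqg => ->.
- by move=> n [->] [->]; constructor.
- by move=> b [->] [->]; constructor.
- by move=> x b b' hb [->] [->]; constructor.
Qed.

(** At a base type the pick can guess [u] itself; at an arrow type the generator is already a value
    and is related to [u] by [RGen]. *)
Lemma rel_generator_value t k (u : value) : closed u -> good t k u ->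
  exists g : value, [/\ evals (generator t) g, rel k u g & closed g].
Proof.
case: t => [||t1 t2] cu gu.
- case: u gu {cu} => // n _; exists (VInt n).
  by split=> //; [exists 0; constructor | exact: RInt].
- case: u gu {cu} => // b _; exists (VBool b).
  by split=> //; [exists 0; constructor | exact: RBool].
- rewrite [generator _]/=; eexists; split; first exact: evals_val.
    by apply: (@RGen _ (TArrow t1 t2)) => //; apply/safe_val.
  exact: (closed_generator (TArrow t1 t2)).
Qed.

Lemma rel_eq_or_fun k (v v' : value) :
  rel k v v' -> v = v' \/ is_fun v /\ is_fun v'.
Proof. by move=> /rel_valP [] *; [left | left | right | right]. Qed.

(** Related values differ only if both are functions, and every operator sends a function operand to
    [Error]. *)
Lemma rel_op_eval k o (v1 v1' v2 v2' : value) :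
  rel k v1 v1' -> rel k v2 v2' -> op_eval o v1 v2 = op_eval o v1' v2'.
Proof.
move=> /rel_eq_or_fun [->|[f1 f1']] /rel_eq_or_fun [->|[f2 f2']] //.
- by case: v2 v2' f2 f2' => // ? ? [].
- by case: v1 v1' f1 f1' => // ? ? [].
- by case: v1 v1' f1 f1' => // ? ? [].
Qed.

Lemma op_eval_outcome o v1 v2 :
  op_eval o v1 v2 = Error \/ exists v, op_eval o v1 v2 = Val v.
Proof.
by case: o; case: v1 => *; case: v2 => *; try (by left); right; eexists.
Qed.

Lemma rel_matches k (v v' : value) p :
  rel k v v' -> matches v p = matches v' p.
Proof.
by move=> /rel_eq_or_fun [-> //|[]]; case: v v' => // ? ? [] // ? ? _ _; case: p.
Qed.

(** The induction hypothesis of [rel_safe], named so that the simulation lemmas can assume it. *)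
Definition rel_safe_below (K : nat) : Prop :=
  forall i, i < K -> forall t e e', closed e -> closed e' ->
  rel i e e' -> ~ fails t e' -> safe (good t) i e.

(* If the argument passed to a generator is not good, then by [IH] the checker
   inside the generator detects it. *)
Lemma sim_app K m i x b (vf' w w' : value) :
  rel_safe_below K -> rel m (VFun x b) vf' -> i < m -> m <= K ->
  closed (VFun x b) -> closed vf' -> closed w -> closed w' ->
  rel i w w' -> ~ evals (App vf' w') Error ->
  exists E', [/\ closed E', rel i (subst x w b) E' &
    forall r, evals E' r -> evals (App vf' w') r].
Proof.
move=> IH hf im mK cf cf' cw cw' hw nE.
have cb := closed_subst cf cw.
have := rel_valP hf; move eqf: (VFun x b) => f R.
case: R hf cf' nE eqf => // {f} [y a b' hb|t1 t2 y a g _ ga eqg fg].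
  move=> _ cf' _ [eqx eqb]; subst y a; exists (subst x w' b'); split.
  - exact: closed_subst.
  - by apply: rel_subst => //; apply: rel_mono hb; exact: ltnW.
  - by move=> r; apply: evals_app; exact: evals_val.
move=> _ cf' nE [eqx eqb]; subst y a.
have red r : evals (If PickB (If (checker_from 1 t1 w') (generator t2) Error)
      (generator t2)) r -> evals (App g w') r.
  move: eqg; rewrite generator_arrow => -[<-] h.
  apply: evals_app; [exact: evals_val | exact: evals_val |].
  by rewrite /= subst_checker_from //= (subst_closed _ _ (closed_generator t2)).
have pickb c : evals PickB (VBool c) by exists 0; constructor.
exists (generator t2); split; first exact: closed_generator.
  apply: RGen => //; apply: ga => //.
  apply/safe_val; apply: (IH i _ t1 w w') => //; first exact: leq_trans mK.
  move=> /(fails_rejects (isT : 0 < 1) cw') rj; apply: nE; apply: red.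
  apply: evals_if (pickb true) _; case: rj => h.
    exact: (evals_fill_error (CIf CHole _ _) h).
  by apply: evals_if h _; exact: evals_Error.
(* The unchecked branch of the generator makes all outcomes of [generator t2] available even when
   the check of [w'] diverges. *)
by move=> r h; apply: red; exact: evals_if (pickb false) h.
Qed.

Lemma rel_gen_sim t k j e r : closed e -> safe (good t) k e -> j <= k ->
  eval j e r ->
  exists v v', [/\ r = Val v, evals (generator t) (Val v') & rel (k - j) v v'].
Proof.
move=> ce he jk h; have [v eqr gv] := he _ _ jk h; subst r.
have [g [h1 h2 _]] := rel_generator_value (eval_closed h ce) gv.
by exists v, g.
Qed.

(** * Simulation and the fundamental lemma *)

(** Induction on the evaluation of [e]. If [e] as a whole was replaced, [rel_gen_sim] answers;
    otherwise [e'] has the same outer shape and is run along with [e]. An error of [e] would be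
    reproduced by [e'], so both sides end in values. *)
Lemma sim_eval K j e r : rel_safe_below K -> eval j e r -> forall k e', k <= K -> j <= k ->
  closed e -> closed e' -> rel k e e' -> ~ evals e' Error ->
  exists v v', [/\ r = Val v, evals e' (Val v') & rel (k - j) v v'].
Proof.
move=> IH ev; elim: ev => {j e r}.
- move=> v k e' _ _ _ _ h _; rewrite subn0.
  inversion h as [t e ce he| | | | | | | | | | |]; subst.
  + rewrite -[k]subn0; exact: rel_gen_sim (EVal v).
  + by do 2 eexists; split; [| exact: evals_val | exact: h].
  + by do 2 eexists; split; [| exact: evals_val | exact: h].
  + by do 2 eexists; split; [| exact: evals_val | exact: h].
- move=> k e' _ _ _ _ h; inversion h as [t e ce he| | | | | | | | | | |]; subst.
  + by have [] := he _ _ (leq0n k) EError.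
  + by case; exact: evals_Error.
- move=> n k e' _ _ _ _ h _.
  inversion h as [t e ce he| | | | | | | | | | |]; subst.
    exact: rel_gen_sim (EPickI n).
  by exists (VInt n), (VInt n); split; [|exists 0; constructor | exact: rel_refl].
- move=> b k e' _ _ _ _ h _.
  inversion h as [t e ce he| | | | | | | | | | |]; subst.
    exact: rel_gen_sim (EPickB b).
  by exists (VBool b), (VBool b); split; [|exists 0; constructor | exact: rel_refl].
- move=> j e p v ev IHe k e' kK jk ce ce' h nE.
  inversion h as [t e0 ce0 he| | | | | | | |e1 e1' p1 h1| | |]; subst.
    by apply: rel_gen_sim (EMatch p ev).
  have nE1 : ~ evals e1' Error.
    by move=> hE; apply: nE; exact: (evals_fill_error (CMatch CHole p) hE).
  have [v1 [v1' [eqv ev1 rv]]] := IHe k e1' kK jk ce ce' h1 nE1.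
  case: eqv => eqv; subst v1; rewrite (rel_matches p rv).
  do 2 eexists; split; [by [] | exact: evals_match ev1 | exact: rel_refl].
- move=> j e p ev IHe k e' kK jk ce ce' h nE.
  inversion h as [t e0 ce0 he| | | | | | | |e1 e1' p1 h1| | |]; subst.
    by have [] := he _ _ jk (EMatchErr p ev).
  have nE1 : ~ evals e1' Error.
    by move=> hE; apply: nE; exact: (evals_fill_error (CMatch CHole p) hE).
  by have [v1 [v1' []]] := IHe k e1' kK jk ce ce' h1 nE1.
- move=> j1 j2 o e1 e2 v1 v2 ev1 IH1 ev2 IH2 k e' kK jk.
  move=> /[dup] ce /closed_op [c1 c2] ce' h nE.
  inversion h as [t e0 ce0 he| | | | | |o1 a a' b b' h1 h2| | | | |]; subst.
    by apply: rel_gen_sim (EOp o ev1 ev2).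
  move: ce' => /closed_op [c1' c2'].
  have nE1 : ~ evals a' Error.
    by move=> hE; apply: nE; exact: (evals_fill_error (COpL o CHole b') hE).
  have [w1 [v1' [eqv ev1' r1]]] := IH1 k a' kK ltac:(lia) c1 c1' h1 nE1.
  case: eqv => eqv; subst w1.
  have nE2 : ~ evals b' Error.
    case: ev1' => l1 hl1 [l2 hl2]; apply: nE.
    by eexists; apply: EOpErrR hl1 hl2.
  have [w2 [v2' [eqv ev2' r2]]] := IH2 (k - j1) b' ltac:(lia) ltac:(lia) c2 c2'
    (rel_mono (leq_subr _ _) h2) nE2.
  case: eqv => eqv; subst w2.
  (* Both operands are brought to the common index [k - (j1 + j2)]. *)
  rewrite -subnDA in r2; have {}r1 := rel_mono (leq_sub2l k (leq_addr j2 j1)) r1.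
  have ev' : evals (Op o a' b') (op_eval o v1' v2').
    by case: ev1' ev2' => l1 hl1 [l2 hl2]; eexists; apply: EOp hl1 hl2.
  rewrite (rel_op_eval o r1 r2).
  case: (op_eval_outcome o v1' v2') ev' => [->|[v ->]] ev'; first by case: nE.
  by exists v, v; split=> //; exact: rel_refl.
- move=> j1 o e1 e2 ev1 IH1 k e' kK jk /[dup] ce /closed_op [c1 c2] ce' h nE.
  inversion h as [t e0 ce0 he| | | | | |o1 a a' b b' h1 h2| | | | |]; subst.
    by have [] := he _ _ jk (EOpErrL o e2 ev1).
  move: ce' => /closed_op [c1' c2'].
  have nE1 : ~ evals a' Error.
    by move=> hE; apply: nE; exact: (evals_fill_error (COpL o CHole b') hE).
  by have [v1 [v1' []]] := IH1 k a' kK jk c1 c1' h1 nE1.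
- move=> j1 j2 o e1 e2 v1 ev1 IH1 ev2 IH2 k e' kK jk.
  move=> /[dup] ce /closed_op [c1 c2] ce' h nE.
  inversion h as [t e0 ce0 he| | | | | |o1 a a' b b' h1 h2| | | | |]; subst.
    by apply: rel_gen_sim (EOpErrR o ev1 ev2).
  move: ce' => /closed_op [c1' c2'].
  have nE1 : ~ evals a' Error.
    by move=> hE; apply: nE; exact: (evals_fill_error (COpL o CHole b') hE).
  have [w1 [v1' [eqv ev1' r1]]] := IH1 k a' kK ltac:(lia) c1 c1' h1 nE1.
  have nE2 : ~ evals b' Error.
    case: ev1' => l1 hl1 [l2 hl2]; apply: nE.
    by eexists; apply: EOpErrR hl1 hl2.
  by have [w2 [v2' []]] := IH2 (k - j1) b' ltac:(lia) ltac:(lia) c2 c2'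
    (rel_mono (leq_subr _ _) h2) nE2.
- move=> j1 j2 e e1 e2 b r ev1 IH1 ev2 IH2 k e' kK jk.
  move=> /[dup] ce /closed_if [c0 c1 c2] ce' h nE.
  inversion h as [t e0 ce0 he| | | | | | |a a' a1 a1' a2 a2' h0 h1 h2| | | |];
    subst.
    by apply: rel_gen_sim (EIf ev1 ev2).
  move: ce' => /closed_if [c0' c1' c2'].
  have nE0 : ~ evals a' Error.
    by move=> hE; apply: nE; exact: (evals_fill_error (CIf CHole a1' a2') hE).
  have [w [w' [eqw ew' rw]]] := IH1 k a' kK ltac:(lia) c0 c0' h0 nE0.
  case: eqw => eqw; subst w.
  case: (rel_eq_or_fun rw) ew' => [<- ew'|[//]].
  have hb : rel (k - j1) (if b then e1 else e2) (if b then a1' else a2').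
    by case: b {IH1 IH2 ev1 ev2 ew' rw}; apply: (@rel_mono _ k); rewrite ?leq_subr.
  have cb : closed (if b then e1 else e2) by case: b {IH1 IH2 ev1 ev2 ew' rw hb}.
  have cb' : closed (if b then a1' else a2').
    by case: b {IH1 IH2 ev1 ev2 ew' rw hb cb}.
  have [|v [v' [eqr ev' rv]]] := IH2 (k - j1) _ ltac:(lia) ltac:(lia) cb cb' hb.
    by move=> hE; apply: nE; exact: evals_if ew' hE.
  exists v, v'; split=> //; first exact: evals_if ew' ev'.
  by rewrite subnDA.
- move=> j1 e e1 e2 v ev1 IH1 nb k e' kK jk.
  move=> /[dup] ce /closed_if [c0 c1 c2] ce' h nE.
  inversion h as [t e0 ce0 he| | | | | | |a a' a1 a1' a2 a2' h0 h1 h2| | | |];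
    subst.
    by have [] := he _ _ jk (EIfBad e1 e2 ev1 nb).
  move: ce' => /closed_if [c0' c1' c2'].
  have nE0 : ~ evals a' Error.
    by move=> hE; apply: nE; exact: (evals_fill_error (CIf CHole a1' a2') hE).
  have [w [w' [eqw [l ew'] rw]]] := IH1 k a' kK jk c0 c0' h0 nE0.
  case: eqw => eqw; subst w; case: nE; exists l; apply: EIfBad ew' _.
  by have := rel_matches PBool rw; rewrite /= => <-.
- move=> j1 e e1 e2 ev1 IH1 k e' kK jk.
  move=> /[dup] ce /closed_if [c0 c1 c2] ce' h nE.
  inversion h as [t e0 ce0 he| | | | | | |a a' a1 a1' a2 a2' h0 h1 h2| | | |];
    subst.
    by have [] := he _ _ jk (EIfErr e1 e2 ev1).
  move: ce' => /closed_if [c0' c1' c2'].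
  have nE0 : ~ evals a' Error.
    by move=> hE; apply: nE; exact: (evals_fill_error (CIf CHole a1' a2') hE).
  by have [w [w' []]] := IH1 k a' kK jk c0 c0' h0 nE0.
- move=> j1 j2 j3 e1 e2 x b v r ev1 IH1 ev2 IH2 ev3 IH3 k e' kK jk.
  move=> /[dup] ce /closed_app [c1 c2] ce' h nE.
  inversion h as [t e0 ce0 he| | | | |a1 a1' a2 a2' h1 h2| | | | | |]; subst.
    by apply: rel_gen_sim (EApp ev1 ev2 ev3).
  move: ce' => /closed_app [c1' c2'].
  have nE1 : ~ evals a1' Error.
    by move=> hE; apply: nE; exact: (evals_fill_error (CAppL CHole a2') hE).
  have nE2 : ~ evals a2' Error.
    by move=> hE; apply: nE; exact: (evals_fill_error (CAppR a1' CHole) hE).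
  have [w1 [vf' [eqv evf' rf]]] := IH1 k a1' kK ltac:(lia) c1 c1' h1 nE1.
  case: eqv => eqv; subst w1.
  have [w2 [v' [eqv ev' rv]]] := IH2 (k - j1) a2' ltac:(lia) ltac:(lia) c2 c2'
    (rel_mono (leq_subr _ _) h2) nE2.
  case: eqv => eqv; subst w2.
  (* By nondeterminism [App a1' a2'] can reach exactly these two values, so it inherits every
     outcome of their application. *)
  have red s : evals (App vf' v') s -> evals (App a1' a2') s.
    move=> hs; apply: (@evals_fill (CAppR a1' CHole) v') => [s' [l hl]|].
      by inversion hl; subst.
    apply: (@evals_fill (CAppL CHole v') vf') hs => s' [l hl].
    by inversion hl; subst.
  have cf := eval_closed ev1 c1; have cv := eval_closed ev2 c2.
  (* The index for the body: running it costs [j3] and must leave [k] minus the total. The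
     beta-reduction makes [i] strictly smaller than [k - j1], as [sim_app] requires. *)
  pose i := k - (j1 + j2 + j3).+1 + j3.
  have rvi : rel i v v' by apply: rel_mono rv; rewrite /i; lia.
  have [|||E' [cE' rE hE]] := sim_app (i := i) IH rf _ _ cf (evals_closed evf' c1')
    cv (evals_closed ev' c2') rvi.
  + by rewrite /i; lia.
  + by lia.
  + by move/red.
  have [|||w [w' [eqr ew' rw]]] := IH3 i E' _ _ (closed_subst cf cv) cE' rE.
  + by rewrite /i; lia.
  + by rewrite /i; lia.
  + by move/hE/red.
  exists w, w'; split=> //; first exact/red/hE.
  by move: rw; rewrite /i addnK.
- move=> j1 j2 e1 e2 v1 v2 ev1 IH1 ev2 IH2 nf k e' kK jk.
  move=> /[dup] ce /closed_app [c1 c2] ce' h nE.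
  inversion h as [t e0 ce0 he| | | | |a1 a1' a2 a2' h1 h2| | | | | |]; subst.
    by have [] := he _ _ jk (EAppBad ev1 ev2 nf).
  move: ce' => /closed_app [c1' c2'].
  have nE1 : ~ evals a1' Error.
    by move=> hE; apply: nE; exact: (evals_fill_error (CAppL CHole a2') hE).
  have nE2 : ~ evals a2' Error.
    by move=> hE; apply: nE; exact: (evals_fill_error (CAppR a1' CHole) hE).
  have [w1 [vf' [eqv [l1 evf'] rf]]] := IH1 k a1' kK ltac:(lia) c1 c1' h1 nE1.
  case: eqv => eqv; subst w1.
  have [w2 [v' [_ [l2 ev'] _]]] := IH2 (k - j1) a2' ltac:(lia) ltac:(lia) c2 c2'
    (rel_mono (leq_subr _ _) h2) nE2.
  case: nE; eexists; apply: EAppBad evf' ev' _.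
  by have := rel_matches PFun rf; rewrite /= => <-.
- move=> j1 e1 e2 ev1 IH1 k e' kK jk /[dup] ce /closed_app [c1 c2] ce' h nE.
  inversion h as [t e0 ce0 he| | | | |a1 a1' a2 a2' h1 h2| | | | | |]; subst.
    by have [] := he _ _ jk (EAppErrL e2 ev1).
  move: ce' => /closed_app [c1' c2'].
  have nE1 : ~ evals a1' Error.
    by move=> hE; apply: nE; exact: (evals_fill_error (CAppL CHole a2') hE).
  by have [w [w' []]] := IH1 k a1' kK jk c1 c1' h1 nE1.
- move=> j1 e1 e2 ev2 IH2 k e' kK jk /[dup] ce /closed_app [c1 c2] ce' h nE.
  inversion h as [t e0 ce0 he| | | | |a1 a1' a2 a2' h1 h2| | | | | |]; subst.
    by have [] := he _ _ jk (EAppErrR e1 ev2).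
  move: ce' => /closed_app [c1' c2'].
  have nE2 : ~ evals a2' Error.
    by move=> hE; apply: nE; exact: (evals_fill_error (CAppR a1' CHole) hE).
  by have [w [w' []]] := IH2 k a2' kK jk c2 c2' h2 nE2.
Qed.

(** Strong induction on [k]. The simulation yields matching values; at an arrow type an arbitrary
    good argument [u] is matched by a generated [g], the kind of argument that [fails] tries. The
    body then runs at an index below [k]. *)
Lemma rel_safe k t e e' : closed e -> closed e' ->
  rel k e e' -> ~ fails t e' -> safe (good t) k e.
Proof.
elim/ltn_ind: k t e e' => k IH t e e' ce ce' ee' nf j r jk h.
have nE : ~ evals e' Error by move/(fails_error t).
have [v [v' [eqr ev' vv']]] := sim_eval IH h (leqnn k) jk ce ce' ee' nE.
exists v => //; subst r.
have M p : ~ rejects (Match e' p) -> matches v p.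
  rewrite (rel_matches p vv') => nr; apply/negPn/negP => /negbTE nm.
  by apply: nr; right; have := evals_match p ev'; rewrite nm.
have cv := eval_closed h ce; have cv' := evals_closed ev' ce'.
case: t nf => [/M //|/M //|t1 t2 nf].
have : matches v PFun by apply: M => nr; apply: nf; left.
case: v h cv vv' {M} => // x b h cv vv' _ i u ik cu gu.
have [g [hg ug cg]] := rel_generator_value cu gu.
have nf2 : ~ fails t2 (App v' g).
  by move=> f2; apply: nf; right; exists v', g.
have [||E' [cE' rE red]] := sim_app IH vv' ik _ cv cv' cu cg ug.
- exact: leq_subr.
- by move/(fails_error t2).
apply: (IH i _ t2 _ E') => //; [lia | exact: closed_subst |].
by move=> /(fails_mono red).
Qed.

(** * Comparison with type checking and semantic typing *)

Lemma TC_valid t e : closed e -> TC e t <-> valid t e.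
Proof.
move=> ce; have [h1 h2] := TC_valid_fails t ce; split=> // /h1 nf k.
(* The simulation is started with nothing replaced. *)
exact: (rel_safe ce ce (rel_refl k e) nf).
Qed.

Lemma valid_value t e (v : value) : valid t e -> evals e v -> valid t v.
Proof.
move=> he [j h] k; apply/safe_val.
have := safe_eval_val (he (j + k)) (leq_addr k j) h.
by rewrite addKn.
Qed.

Lemma valid_no_error t e : valid t e -> ~ evals e Error.
Proof. by move=> he [k h]; have [] := he _ _ _ (leqnn k) h. Qed.

Lemma sem_no_error t e : sem_typed e t -> ~ evals e Error.
Proof. by case: t => [||t1 t2] [nE _] /steps_ErrorP. Qed.

Lemma rejects_match e p : rejects (Match e p) ->
  evals e Error \/ exists2 v : value, evals e v & ~~ matches v p.
Proof.
case=> -[k h].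
  by inversion h; subst; left; exists k.
have [v hv eqr] : exists2 v : value, eval k e v & VBool false = VBool (matches v p).
  by inversion h as [| | | |k' e' p' v h1| | | | | | | | | | |]; exists v.
by right; exists v; [exists k | case: eqr => <-].
Qed.

(** From semantic typing it suffices to exclude counterexamples. Generated arguments are valid,
    hence semantically typed, so the application is semantically typed and by induction valid; the
    checker accepts it. Conversely, valid functions preserve validity. *)
Lemma sem_typed_valid t e : closed e -> sem_typed e t <-> valid t e.
Proof.
elim: t e => [||t1 IH1 t2 IH2] e ce; split=> [[nE T]|he].
- move=> k; apply: (rel_safe ce ce (rel_refl k e)).
  by move=> /rejects_match [/steps_ErrorP //|[v /steps_valP /T /= ->]].
- split; first by move/steps_ErrorP; exact: valid_no_error he.
  by move=> v /steps_valP /(valid_value he) /(_ 0) /safe_val.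
- move=> k; apply: (rel_safe ce ce (rel_refl k e)).
  by move=> /rejects_match [/steps_ErrorP //|[v /steps_valP /T /= ->]].
- split; first by move/steps_ErrorP; exact: valid_no_error he.
  by move=> v /steps_valP /(valid_value he) /(_ 0) /safe_val.
- have app (vf g : value) : evals e vf -> evals (generator t1) g ->
      closed (App vf g) /\ sem_typed (App vf g) t2.
    move=> hf hg; have cg := evals_closed hg (closed_generator t1).
    split; first by apply/closed_app; split=> //; exact: evals_closed hf ce.
    apply: T => //; first exact/steps_valP.
    by apply/IH1 => //; apply: valid_value hg; exact: generator_valid.
  move=> k; apply: (rel_safe ce ce (rel_refl k e)).
  case=> [/rejects_match [/steps_ErrorP //|[v hv nf]]|[vf [g [hf hg]]]].
    (* Semantic typing at an arrow type sees that [v] is no function only by applying it, so some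
       argument of type [t1] must exist; the generator supplies one. *)
    have [g hg] : exists g : value, evals (generator t1) g.
      case: t1 {IH1 T app} => [||t1 t1'].
      + by exists (VInt (ssrint.Posz 0)), 0; constructor.
      + by exists (VBool true), 0; constructor.
      + by eexists; exact: evals_val.
    have [_ /sem_no_error] := app v g hv hg; apply.
    by exists 0; apply: (EAppBad (k1 := 0) (EVal v) (EVal g)).
  have [ca sa] := app vf g hf hg.
  by have [+ _] := TC_valid_fails t2 ca; apply; apply/TC_valid/IH2.
- split; first by move/steps_ErrorP; exact: valid_no_error he.
  move=> vf /steps_valP hvf v cv /(IH1 _ cv) hv; apply/IH2.
    by apply/closed_app; split=> //; exact: evals_closed hvf ce.
  move=> k; apply: (safe_app cv (@valid_value _ _ _ he hvf k)).
  by apply/safe_val; exact: hv.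
Qed.

Theorem theorem3p8 (e : expr) (t : ty) (he : closed e) : TC e t <-> sem_typed e t.
Proof. by rewrite TC_valid // sem_typed_valid. Qed.
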